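(* Let $X$ be a random variable on a finite set $\mathcal{X}$ with distribution $p_X$, let $\mathcal{H}$ be a finite-dimensional Hilbert space, and let $\mathcal{E}=\{(\rho_x,p_X(x))\}_{x\in\mathcal{X}}$ be a quantum ensemble of density matrices on $\mathcal{H}$. For every deterministic function $f$ defined on $\mathcal{X}$, $$G(f(X)|\mathcal{E})\le G(X|\mathcal{E}).$$
   Context: A POVM on $\mathcal{H}$ is a family $E=\{E_y\}_{y\in\mathcal{Y}}$, indexed by a finite set $\mathcal{Y}$ (which may depend on $E$), of positive semidefinite operators on $\mathcal{H}$ with $\sum_yE_y=I$. Given $\mathcal{E}$ and a POVM $E$, $Y_E$ is the $\mathcal{Y}$-valued random variable whose joint law with $X$ is $p_{X,Y_E}(x,y)=p_X(x)\operatorname{Tr}[E_y\rho_x]$. For a random variable $Z$ taking values in a finite set of size $m$ and a random variable $Y$ with finitely many values, jointly distributed, the classical conditional guessing entropy is $G(Z|Y)=\mathbb{E}_Y\sum_{i=1}^m i\cdot p^{\downarrow}_{Z|Y}(z_i|Y)$, where for each $y$ the numbers $p^{\downarrow}_{Z|Y}(z_1|y)\ge\dots\ge p^{\downarrow}_{Z|Y}(z_m|y)$ are the conditional probabilities of the values of $Z$ given $Y=y$, sorted in descending order. The quantum guesswork of $X$ given $\mathcal{E}$ is $G(X|\mathcal{E})=\inf_EG(X|Y_E)$, over all POVMs $E$ on $\mathcal{H}$. Likewise $G(f(X)|\mathcal{E})=\inf_EG(f(X)|Y_E)$, over all POVMs $E$ on $\mathcal{H}$, where the joint law of $(f(X),Y_E)$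 is the one induced by the joint law of $(X,Y_E)$. *)

(* Defs.v *)
From mathcomp Require Import all_boot all_order all_algebra.
From mathcomp Require Import sesquilinear spectral.
From mathcomp Require Import complex.
From mathcomp Require Import boolp classical_sets reals.

Set Implicit Arguments.
Unset Strict Implicit.
Unset Printing Implicit Defensive.

Import Order.TTheory GRing.Theory Num.Theory.

Local Open Scope ring_scope.
Local Open Scope complex_scope.
Local Open Scope sesquilinear_scope.
Local Open Scope classical_set_scope.

(* The Hilbert space is C^d, and operators on it are d x d complex matrices. *)

Definition is_psd (R : realType) (d : nat) (A : 'M[R[i]]_d) : Prop :=
  A \is hermsymmx /\
  forall v : 'cV[R[i]]_d, 0 <= (v ^t* *m A *m v) ord0 ord0.

Definition is_density (R : realType) (d : nat) (rho : 'M[R[i]]_d) : Prop :=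
  is_psd rho /\ \tr rho = 1.

Definition is_povm (R : realType) (d : nat) (Y : finType)
    (E : Y -> 'M[R[i]]_d) : Prop :=
  (forall y, is_psd (E y)) /\ \sum_y E y = 1%:M.

Definition is_distribution (R : realType) (X : finType) (p : X -> R) : Prop :=
  (forall x, 0 <= p x) /\ \sum_x p x = 1.

Definition is_ensemble (R : realType) (d : nat) (X : finType)
    (p : X -> R) (rho : X -> 'M[R[i]]_d) : Prop :=
  is_distribution p /\ forall x, is_density (rho x).

(* The trace is a real number when E y and rho x are positive semidefinite;
   Re only casts it from R[i] to R. *)
Definition measured_law (R : realType) (d : nat) (X Y : finType)
    (p : X -> R) (rho : X -> 'M[R[i]]_d) (E : Y -> 'M[R[i]]_d)
    (x : X) (y : Y) : R :=
  p x * complex.Re (\tr (E y *m rho x)).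

(* Joint law of (f(X), Y) when P is the joint law of (X, Y). *)
Definition law_image (R : realType) (X Z Y : finType) (f : X -> Z)
    (P : X -> Y -> R) (z : Z) (y : Y) : R :=
  \sum_(x | f x == z) P x y.

Definition marginal (R : realType) (Z Y : finType) (P : Z -> Y -> R)
    (y : Y) : R :=
  \sum_z P z y.

(* When marginal P y = 0 this is the zero function; such a y has weight 0
   in guess_entropy. *)
Definition conditional (R : realType) (Z Y : finType) (P : Z -> Y -> R)
    (y : Y) (z : Z) : R :=
  P z y / marginal P y.

Definition sorted_conditional (R : realType) (Z Y : finType) (P : Z -> Y -> R)
    (y : Y) : seq R :=
  sort >=%R [seq conditional P y z | z : Z].

(* Ranks start at 1 while sequence positions start at 0. *)
Definition guess_entropy (R : realType) (Z Y : finType) (P : Z -> Y -> R) : R :=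
  \sum_y marginal P y *
    \sum_(i < #|Z|) (i.+1)%:R * (sorted_conditional P y)`_i.

(* inf is not a default value here: on an ensemble the set contains the value
   of the one-outcome POVM and is bounded below by 0. *)
Definition guesswork (R : realType) (d : nat) (X : finType)
    (p : X -> R) (rho : X -> 'M[R[i]]_d) : R :=
  inf [set g : R | exists (Y : finType) (E : Y -> 'M[R[i]]_d),
    is_povm E /\ g = guess_entropy (measured_law p rho E)].

Definition guesswork_image (R : realType) (d : nat) (X Z : finType)
    (f : X -> Z) (p : X -> R) (rho : X -> 'M[R[i]]_d) : R :=
  inf [set g : R | exists (Y : finType) (E : Y -> 'M[R[i]]_d),
    is_povm E /\ g = guess_entropy (law_image f (measured_law p rho E))].

(* Main.v *)
(** Sorting a nonnegative vector [w] in descending order gives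
    [sum_i i * w_i = (sum_(z, z') min (w z) (w z') + sum_z w z) / 2], because
    the smaller of two sorted entries is the later one. For fixed outcome [y],
    [f] merges the entries of the conditional law over its fibres; this keeps
    the sum of the entries and, [min] being subadditive in each nonnegative
    argument, does not increase the double sum of minima. Hence every POVM
    guesses [f(X)] at most as late as it guesses [X]. *)

Require Import Defs.
From mathcomp Require Import all_boot all_order all_algebra.
From mathcomp Require Import complex reals.
From mathcomp Require Import sesquilinear spectral.
From mathcomp Require Import ring lra.
Import Order.TTheory GRing.Theory Num.Theory.
Local Open Scope ring_scope.
Local Open Scope complex_scope.

(** By induction: the head [a] is a maximum, so its row and its column in the double sum each add
    the sum of the tail. After halving, one copy remains, which pays for every rank in the tail
    going up by one. *)
Lemma sum_rank_sorted (R : realFieldType) (s : seq R) : sorted >=%R s ->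
  \sum_(i < size s) i.+1%:R * s`_i =
  (\sum_(a <- s) \sum_(b <- s) Num.min a b + \sum_(a <- s) a) / 2.
Proof.
elim: s => [|a s IHs] /= s_sorted; first by rewrite big_ord0 !big_nil addr0 mul0r.
have /allP a_max : all (>=%R a) s.
  by apply: order_path_min s_sorted => x y z /= yx xz; apply: le_trans xz yx.
have min_a : {in s, forall b, Num.min a b = b} by move=> b /a_max /min_r.
rewrite big_ord_recl /= mul1r !big_cons minxx.
have -> : \sum_(b <- s) Num.min a b = \sum_(b <- s) b by exact: eq_big_seq.
have -> : \sum_(b <- s) \sum_(c <- a :: s) Num.min b c =
    \sum_(b <- s) b + \sum_(b <- s) \sum_(c <- s) Num.min b c.
  rewrite -big_split; apply: eq_big_seq => b bs.
  by rewrite big_cons minC min_a.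
have -> : \sum_(i < size s) (bump 0 i).+1%:R * s`_i =
    \sum_(b <- s) b + \sum_(i < size s) i.+1%:R * s`_i.
  rewrite (big_nth 0) big_mkord -big_split /=; apply: eq_bigr => i _.
  by rewrite /bump add1n -[i.+2]addn1 natrD mulrDl mul1r addrC.
by rewrite IHs ?(path_sorted s_sorted) //; field.
Qed.

Lemma min_sum_le (R : realDomainType) (I : finType) (P : pred I) (a : I -> R) b :
  0 <= b -> (forall i, 0 <= a i) ->
  Num.min (\sum_(i | P i) a i) b <= \sum_(i | P i) Num.min (a i) b.
Proof.
(* The invariant carries [0 <= x] because [min] with [b] is subadditive only on nonnegative
   arguments. *)
move=> b0 a0; pose K (x y : R) := 0 <= x /\ Num.min x b <= y.
suff [] : K (\sum_(i | P i) a i) (\sum_(i | P i) Num.min (a i) b) by [].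
apply: big_ind2 => [|x x' y y' [x0 xx'] [y0 yy']|i _]; split=> //.
- by rewrite ge_min lexx.
- exact: addr_ge0.
- apply: le_trans (lerD xx' yy').
  by case: (leP (x + y) b); case: (leP x b); case: (leP y b); lra.
Qed.

Lemma sum_min_image_le (R : realDomainType) (X Z : finType) (f : X -> Z)
    (q : X -> R) : (forall x, 0 <= q x) ->
  \sum_z \sum_z' Num.min (\sum_(x | f x == z) q x) (\sum_(x | f x == z') q x) <=
  \sum_x \sum_x' Num.min (q x) (q x').
Proof.
move=> q0; rewrite [leRHS](partition_big f xpredT) //=; apply: ler_sum => z _.
rewrite [leRHS]exchange_big [leRHS](partition_big f xpredT) //=.
apply: ler_sum => z' _.
apply: le_trans (min_sum_le _ _ _ _ _ _ q0) _; first exact: sumr_ge0.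
rewrite [leRHS]exchange_big /=; apply: ler_sum => x _.
rewrite minC; apply: le_trans (min_sum_le _ _ _ _ _ _ q0) _ => //.
by apply: ler_sum => x' _; rewrite minC.
Qed.

(** The right-hand side is symmetric in the entries, so the sorting disappears and fibres of a
    function can be merged without tracking ranks. *)
Lemma sum_rank_conditional (R : realType) (Z Y : finType) (P : Z -> Y -> R) y :
  \sum_(i < #|Z|) i.+1%:R * (sorted_conditional P y)`_i =
  (\sum_z \sum_z' Num.min (conditional P y z) (conditional P y z') +
   \sum_z conditional P y z) / 2.
Proof.
have sort_big (F : R -> R) :
    \sum_(a <- sorted_conditional P y) F a = \sum_z F (conditional P y z).
  by rewrite (perm_big _ (permEl (perm_sort _ _))) big_image.
have <- : size (sorted_conditional P y) = #|Z|.
  by rewrite size_sort size_map cardE.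
rewrite sum_rank_sorted; last by apply: sort_sorted => a b; exact: ge_total.
by rewrite !sort_big; under eq_bigr do rewrite sort_big.
Qed.

Section NonnegativeLaw.
Context (R : realType) (X Z Y : finType) (f : X -> Z) (P : X -> Y -> R).
Hypothesis P0 : forall x y, 0 <= P x y.

Lemma marginal_ge0 y : 0 <= marginal P y.
Proof. exact: sumr_ge0. Qed.

Lemma conditional_ge0 y x : 0 <= conditional P y x.
Proof. exact: divr_ge0 (P0 _ _) (marginal_ge0 _). Qed.

Lemma guess_entropy_ge0 : 0 <= guess_entropy P.
Proof.
apply: sumr_ge0 => y _; apply: mulr_ge0; first exact: marginal_ge0.
rewrite sum_rank_conditional divr_ge0 // addr_ge0 //; last first.
  by apply: sumr_ge0 => x _; exact: conditional_ge0.
by do 2 (apply: sumr_ge0 => ? _); rewrite le_min !conditional_ge0.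
Qed.

Lemma law_image_ge0 z y : 0 <= law_image f P z y.
Proof. exact: sumr_ge0. Qed.

Lemma marginal_image y : marginal (law_image f P) y = marginal P y.
Proof. by rewrite /marginal [RHS](partition_big f xpredT). Qed.

Lemma conditional_image y z :
  conditional (law_image f P) y z = \sum_(x | f x == z) conditional P y x.
Proof. by rewrite /conditional marginal_image mulr_suml. Qed.

Lemma guess_entropy_image_le : guess_entropy (law_image f P) <= guess_entropy P.
Proof.
apply: ler_sum => y _; rewrite marginal_image ler_wpM2l ?marginal_ge0 //.
rewrite !sum_rank_conditional ler_wpM2r ?invr_ge0 // lerD //.
  under eq_bigr do under eq_bigr do rewrite !conditional_image.
  exact: sum_min_image_le (conditional_ge0 y).
under eq_bigr do rewrite conditional_image.
by rewrite [leRHS](partition_big f xpredT).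
Qed.

End NonnegativeLaw.

Local Open Scope sesquilinear_scope.

(** The entry is the quadratic form of [A] at the conjugate transpose of row [i] of [U]. *)
Lemma psd_form_ge0 (R : realType) d (A : 'M[R[i]]_d) (U : 'M[R[i]]_d) i :
  is_psd A -> 0 <= (U *m A *m U^t*) i i.
Proof.
move=> [_ /(_ ((row i U)^t*))].
suff -> : ((row i U)^t*^t* *m A *m (row i U)^t*) ord0 ord0 =
  (U *m A *m U^t*) i i by [].
rewrite trmxCK -row_mul !mxE; apply: eq_bigr => k _.
by rewrite !mxE.
Qed.

(* In an orthonormal eigenbasis of [B] the trace is the sum of the diagonal
   entries of [A] weighted by the eigenvalues of [B]. *)
Lemma psd_trace_mul_ge0 (R : realType) d (A B : 'M[R[i]]_d) :
  is_psd A -> is_psd B -> 0 <= \tr (A *m B).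
Proof.
move=> Apsd Bpsd; have Bherm := Bpsd.1.
have Bnormal : B \is normalmx by apply: hermitian_normalmx.
have /orthomx_spectralP := Bnormal.
set U := spectralmx B; set D := spectral_diag B => BE.
have Uunitary : U \is unitarymx by apply: spectral_unitarymx.
rewrite (invmx_unitary Uunitary) in BE.
have /unitarymxP UU := Uunitary.
(* The eigenvalue [D 0 i] is the [i]-th diagonal entry of [U *m B *m U^t*]. *)
have D0 i : 0 <= D 0 i.
  have := psd_form_ge0 _ _ _ U i Bpsd.
  rewrite BE !mulmxA UU mul1mx -mulmxA UU mulmx1.
  by rewrite !mxE eqxx mulr1n.
rewrite BE mulmxA mxtrace_mulC !mulmxA /mxtrace sumr_ge0 // => i _.
by rewrite mul_mx_diag mxE mulr_ge0 // psd_form_ge0.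
Qed.

Lemma measured_law_ge0 (R : realType) (d : nat) (X Y : finType) (p : X -> R)
    (rho : X -> 'M[R[i]]_d) (E : Y -> 'M[R[i]]_d) x y :
  is_ensemble p rho -> is_povm E -> 0 <= measured_law p rho E x y.
Proof.
move=> [[p0 _] rho_density] [Epsd _]; apply: mulr_ge0 => //.
have := psd_trace_mul_ge0 _ _ _ _ (Epsd y) (rho_density x).1.
(* In [R[i]], [0 <= z] says that [z] has zero imaginary part and nonnegative real part. *)
by rewrite lecE => /andP[].
Qed.

Lemma povm_one (R : realType) d : is_povm (fun _ : unit => 1%:M : 'M[R[i]]_d).
Proof.
split; last by rewrite big_const card_unit /= addr0.
move=> _; split.
  by apply/is_hermitianmxP; rewrite expr0 scale1r trmx1 map_mx1.
move=> v; rewrite mulmx1 mxE sumr_ge0 // => i _.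
by rewrite !mxE mulrC mul_conjC_ge0.
Qed.

Theorem corollary1 (R : realType) (d : nat) (X Z : finType)
    (p : X -> R) (rho : X -> 'M[R[i]]_d) (f : X -> Z)
    (hE : is_ensemble p rho) :
  guesswork_image f p rho <= guesswork p rho.
Proof.
(* Bounding an infimum from below needs a nonempty set; the one-outcome POVM supplies an element. *)
apply: lb_le_inf => [|_ [Y [E [Epovm ->]]]].
  by exists (guess_entropy (measured_law p rho (fun _ : unit => 1%:M)));
    exists unit, (fun _ => 1%:M); split=> //; exact: povm_one.
(* The same POVM [E] serves as a candidate for guessing [f(X)]. *)
apply: le_trans (guess_entropy_image_le _ _ _ _ f _ _); last first.
  by move=> x y; exact: measured_law_ge0.
apply: ge_inf; last by exists Y, E.
(* An infimum lies below each member only when the set has a lower bound, here 0. *)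
exists 0 => _ [Y' [E' [E'povm ->]]].
apply: guess_entropy_ge0; apply: law_image_ge0 => x y.
exact: measured_law_ge0.
Qed.
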